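(* Let the reference distribution be the two-point empirical distribution $P_0=\{(\hat v_1,\alpha_1),(\hat v_2,\alpha_2)\}$, and let $\tau>0$ be the revenue target. Then $\mu_0=\alpha_1\hat v_1+\alpha_2\hat v_2$, $\Pi_0=\max(\hat v_1,(1-\alpha_1)\hat v_2)$, and the satisficing problem $$\min_{k>0}\ k\quad\text{s.t.}\quad\tau\le\max_{p\in[0,1]}\left\{\sum_{n=1}^2\alpha_n\inf_{v\in[0,1]}\left[p\,\mathbf 1(v\ge p)+k|\hat v_n-v|\right]\right\}$$ is feasible if and only if $\tau\le\Pi_0$, with the optimal solution (optimal fragility $k_{RS}^{PP}$ and optimal posted price $p_{RS}^{PP}$) given by: 1) If $\hat v_1\le(1-\alpha_1)\hat v_2$, then $\Pi_0=(1-\alpha_1)\hat v_2$, and $$p_{RS}^{PP}=\frac{k_{RS}^{PP}}{k_{RS}^{PP}+1}\hat v_2,\qquad k_{RS}^{PP}=\begin{cases}\dfrac{\mu_0-\tau-\sqrt{(\mu_0-\tau)^2-4\alpha_1\tau(\hat v_2-\hat v_1)}}{2\alpha_1(\hat v_2-\hat v_1)}, & \text{if }\tau\le(1-\alpha_1)\hat v_1,\\[3mm]\dfrac{\tau}{(1-\alpha_1)\hat v_2-\tau}, & \text{if }(1-\alpha_1)\hat v_1<\tau\le(1-\alpha_1)\hat v_2.\end{cases}$$ 2) Otherwise, if $\hat v_1>(1-\alpha_1)\hat v_2$, then $\Pi_0=\hat v_1$, and $$\left(p_{RS}^{PP},k_{RS}^{PP}\right)=\begin{cases}\left(\dfrac{k_{RS}^{PP}}{k_{RS}^{PP}+1}\hat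 v_2,\ \dfrac{\mu_0-\tau-\sqrt{(\mu_0-\tau)^2-4\alpha_1\tau(\hat v_2-\hat v_1)}}{2\alpha_1(\hat v_2-\hat v_1)}\right), & \text{if }\tau\le(1-\alpha_1)\hat v_1,\\[3mm]\left(\dfrac{k_{RS}^{PP}}{k_{RS}^{PP}+1}\hat v_1,\ \dfrac{\tau}{\hat v_1-\tau}\right), & \text{if }(1-\alpha_1)\hat v_1<\tau\le\hat v_1.\end{cases}$$
   Context: $\{(\hat v_1,\alpha_1),(\hat v_2,\alpha_2)\}$ denotes the discrete distribution on two points $\hat v_1<\hat v_2$ in $[0,1]$ with probabilities $\alpha_1,\alpha_2\ge0$, $\alpha_1+\alpha_2=1$. $\mu_0$ is its mean and $\Pi_0=\max_{p\in[0,1]}p\,\mathbb P_{P_0}(\tilde v\ge p)$ is the maximal expected posted-price revenue under it, where $\tilde v$ is the buyer's random valuation. $\mathbf 1(\cdot)$ is the indicator function. $k_{RS}^{PP}$ is the optimal value of $k$ in the problem, and $p_{RS}^{PP}$ is a price $p$ attaining the maximum in the constraint at $k=k_{RS}^{PP}$.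
   Formalization: k ranges over (0,+∞] with +∞·0=0, since at τ=Π₀ no finite k is feasible and the formula reads τ/0 (taken as k=+∞, k/(k+1)=1); when α₁=0 the square-root formula is 0/0 and is replaced by its limit τ/(μ₀−τ). *)

(* Defs.v *)
From HB Require Import structures.
From mathcomp Require Import all_boot all_order all_algebra.
From mathcomp Require Import all_classical all_reals all_analysis.

Set Implicit Arguments.
Unset Strict Implicit.
Unset Printing Implicit Defensive.

Import Order.TTheory GRing.Theory Num.Theory.
Import numFieldNormedType.Exports.

Local Open Scope classical_set_scope.
Local Open Scope ring_scope.
Local Open Scope ereal_scope.

Section two_point.
Context {R : realType} (v1 v2 a1 a2 : R).
Hypotheses (a1_ge0 : (0 <= a1)%R) (a2_ge0 : (0 <= a2)%R) (a12 : (a1 + a2 = 1)%R).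

(* The weight hypotheses are arguments, so that the law is a [probability] on
   the Borel sets of R. *)
Definition two_point of (a1 + a2 = 1)%R : set R -> \bar R :=
  measure_add (mscale (NngNum a1_ge0) \d_v1) (mscale (NngNum a2_ge0) \d_v2).

HB.instance Definition _ := Measure.on (two_point a12).

Let two_point_setT : two_point a12 setT = 1.
Proof.
rewrite /two_point measure_addE /= /mscale /= !dirac_measure.diracT.
by rewrite !mule1 -EFinD a12.
Qed.

HB.instance Definition _ :=
  Measure_isProbability.Build _ _ _ (two_point a12) two_point_setT.

End two_point.

Section posted_price.
Context {R : realType}.

Definition mean (P : probability R R) : \bar R := 'E_P[idfun].

Definition posted_price_revenue (P : probability R R) (p : R) : \bar R :=
  p%:E * P [set w | (p <= w)%R].

Definition max_revenue (P : probability R R) : \bar R :=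
  ereal_sup [set posted_price_revenue P p | p in `[0%R, 1%R]].

(* The fragility k ranges over the extended reals.  As +oo * 0 = 0, at k = +oo
   the infimum is the revenue at the valuation v itself. *)
Definition penalized_revenue (k : \bar R) (p v : R) : \bar R :=
  ereal_inf [set (p * (p <= w)%R%:R)%R%:E + k * `|v - w|%R%:E | w in `[0%R, 1%R]].

Variables v1 v2 a1 a2 : R.

Definition robust_revenue (k : \bar R) (p : R) : \bar R :=
  a1%:E * penalized_revenue k p v1 + a2%:E * penalized_revenue k p v2.

Definition max_robust_revenue (k : \bar R) : \bar R :=
  ereal_sup [set robust_revenue k p | p in `[0%R, 1%R]].

(* The value +oo is admitted because the target tau = Pi_0 is met by no finite
   k, although the optimal fragility tau / (Pi_0 - tau) is still meaningful,
   namely +oo. *)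
Definition rs_feasible (tau : R) (k : \bar R) : Prop :=
  0 < k /\ tau%:E <= max_robust_revenue k.

Definition rs_optimal (tau : R) (p : R) (k : \bar R) : Prop :=
  [/\ rs_feasible tau k,
      forall k', rs_feasible tau k' -> k <= k',
      p \in `[0%R, 1%R] &
      robust_revenue k p = max_robust_revenue k].

End posted_price.

(* k / (k + 1), with its limit 1 at k = +oo. *)
Definition shading {R : realType} (k : \bar R) : R :=
  match k with
  | r%:E => (r / (r + 1))%R
  | +oo => 1%R
  | -oo => 0%R
  end.

(* The smaller root of a1 (v2 - v1) k^2 - (mu0 - tau) k + tau = 0.  For a1 = 0
   the closed form reads 0 / 0 and is given its limit as a1 -> 0, the root of
   the then linear equation. *)
Definition root_fragility {R : realType} (mu0 v1 v2 a1 tau : R) : R :=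
  (if a1 == 0 then tau / (mu0 - tau)
   else (mu0 - tau - Num.sqrt ((mu0 - tau) ^+ 2 - 4 * a1 * tau * (v2 - v1)))
        / (2 * a1 * (v2 - v1)))%R.

(* Extended division: the value is +oo when tau = Pi and tau > 0. *)
Definition ratio_fragility {R : realType} (Pi tau : R) : \bar R :=
  tau%:E / (Pi - tau)%:E.

(* Main.v *)
Require Import Defs.
From mathcomp Require Import all_boot all_order all_algebra.
From mathcomp Require Import all_classical all_reals all_analysis.
From mathcomp Require Import measurable_realfun ring lra.

Set Implicit Arguments.
Unset Strict Implicit.
Unset Printing Implicit Defensive.

Import Order.TTheory GRing.Theory Num.Theory.
Import numFieldNormedType.Exports.

Local Open Scope classical_set_scope.
Local Open Scope ring_scope.
Local Open Scope ereal_scope.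

(** Write s = k / (k + 1), with s = 1 at k = +oo.  Against a buyer of valuation
    v, nature either leaves the valuation alone and lets the seller earn p, or
    pays k (v - p) to push it just below the price.  For finite k the penalized
    revenue is therefore the positive part of min (p, k (v - p)): a tent in p
    whose peak s v is the price at which the two options cost the same.

    With two valuations, the robust revenue is a mixture of two tents.  It
    increases up to s v1, is convex between the two peaks (the tent of v1 is
    linear there until it saturates at 0), and does not increase after s v2.
    So it is maximal at s v1 or at s v2 (robust_revenue_le_shading), for
    every k up to and including +oo, where it is the ordinary posted-price
    revenue under P0.  This gives Pi_0, the attainment of the maxima and the
    feasibility criterion.  At s v1 the seller earns s v1; at s v2, for finite
    k, she earns the larger of a2 s v2 and
      g(k) = a1 k (v1 - s v2) + a2 s v2,
    and (tau - g(k)) (k + 1) is the quadratic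
      Q(k) = a1 (v2 - v1) k^2 - (mu0 - tau) k + tau.

    If tau <= a2 v1, then Q is nonpositive at v1 / (v2 - v1) and, when a1 > 0,
    at a2 / a1, so its smaller root is at most both.  These two bounds make
    g dominate a2 s v2 and s v1, respectively.  Hence the maximal robust revenue
    is g up to the root, where it first reaches tau (rs_optimal_root).

    If tau > a2 v1, then g does not help: it never exceeds the
    largest of a2 v1, s v1 and a2 s v2 (two_value_revenue_le).  So tau is
    reached exactly when s Pi_0 reaches it, that is at k = tau / (Pi_0 - tau),
    which is +oo for tau = Pi_0, and the best price is s v1 or s v2 according to
    which of v1 and a2 v2 realizes Pi_0 (rs_optimal_ratio). *)

(** * The two-point law *)

Lemma integral_two_point (R : realType) (v1 v2 a1 a2 : R)
    (a1_ge0 : (0 <= a1)%R) (a2_ge0 : (0 <= a2)%R) (a12 : (a1 + a2 = 1)%R)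
    (f : R -> \bar R) : measurable_fun setT f -> (forall x, 0 <= f x) ->
  \int[two_point v1 v2 a1_ge0 a2_ge0 a12]_x f x = a1%:E * f v1 + a2%:E * f v2.
Proof.
move=> mf f0; rewrite ge0_integral_measure_add//.
by rewrite !ge0_integral_mscale// !integral_dirac// !diracT !mul1e.
Qed.

Lemma mean_two_point (R : realType) (v1 v2 a1 a2 : R)
    (a1_ge0 : (0 <= a1)%R) (a2_ge0 : (0 <= a2)%R) (a12 : (a1 + a2 = 1)%R) :
  mean (two_point v1 v2 a1_ge0 a2_ge0 a12 : probability R R) =
  (a1 * v1 + a2 * v2)%:E.
Proof.
rewrite /mean unlock integralE !integral_two_point//; last 2 first.
- by apply/measurable_funeneg/measurable_EFinP; exact: measurable_id.
- by apply/measurable_funepos/measurable_EFinP; exact: measurable_id.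
rewrite !funeposE !funenegE -!EFinN -!EFin_max -!EFinM -!EFinD.
congr EFin; have posneg x : x = (Num.max x 0 - Num.max (- x) 0)%R :> R.
  by rewrite /Num.max; do 2 case: ifPn; lra.
rewrite [in RHS](posneg v1) [in RHS](posneg v2); ring.
Qed.

(** * Nature's best response to a price *)

Section penalized_revenue.
Context {R : realType}.
Implicit Types p v : R.

Lemma penalized_revenue_le_revenue (k : \bar R) p v : v \in `[0%R, 1%R] ->
  penalized_revenue k p v <= (p * (p <= v)%R%:R)%:E.
Proof.
move=> v01; apply: ereal_inf_lbound; exists v => //.
by rewrite subrr normr0 mule0 adde0.
Qed.

Lemma penalized_revenue_pinfty p v : v \in `[0%R, 1%R] ->
  penalized_revenue +oo p v = (p * (p <= v)%R%:R)%:E.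
Proof.
move=> v01; apply/eqP; rewrite eq_le penalized_revenue_le_revenue//=.
apply/ereal_infP => _ [w _ <-]; have [->|vw] := eqVneq v w.
  by rewrite subrr normr0 mule0 adde0.
by rewrite gt0_mulye ?addey ?leey// lte_fin normr_gt0 subr_eq0.
Qed.

(** When 0 <= k (v - p) < p, the infimum k (v - p) is approached, but not
    attained, by valuations just below the price. *)
Lemma penalized_revenue_fin (k p v : R) : (0 < k)%R ->
  p \in `[0%R, 1%R] -> v \in `[0%R, 1%R] ->
  penalized_revenue k%:E p v =
  (Num.max 0 (Num.min p (k * (v - p))))%:E.
Proof.
move=> k0 p01 v01; have /andP[p0 p1] : (0 <= p <= 1)%R by rewrite in_itv in p01.
apply/eqP; rewrite eq_le; apply/andP; split.
  have [vp|pv] := ltP v p.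
    apply: le_trans (penalized_revenue_le_revenue _ _ v01) _.
    by rewrite (leNgt p v) vp/= mulr0 lee_fin le_max lexx.
  have [pk|kp] := leP p (k * (v - p))%R.
    apply: le_trans (penalized_revenue_le_revenue _ _ v01) _.
    by rewrite pv mulr1 lee_fin le_max lexx orbT.
  have {}p0 : (0 < p)%R by have : (0 <= k * (v - p))%R; [apply: mulr_ge0; lra|lra].
  apply/lee_addgt0Pr => e e0.
  have ek0 : (0 < e / k)%R by rewrite divr_gt0.
  (* The maximum with 0 keeps the perturbed valuation in the unit interval. *)
  pose w := Num.max 0%R (p - e / k)%R.
  have wp : (w < p)%R by rewrite gt_max p0/=; lra.
  have w0 : (0 <= w)%R by rewrite le_max lexx.
  have we : (p - e / k <= w)%R by rewrite le_max lexx orbT.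
  apply: (@le_trans _ _ (k * (v - w))%:E).
    apply: ereal_inf_lbound; exists w; first by rewrite /= in_itv/=; lra.
    rewrite (leNgt p w) wp/= mulr0 add0r; congr (_ * _%:E).
    by rewrite ger0_norm//; lra.
  have pwe : ((p - w) * k <= e)%R by rewrite -ler_pdivlMr//; lra.
  rewrite -EFinD lee_fin; apply: (@le_trans _ _ (k * (v - p) + e)%R); first by lra.
  by rewrite lerD2r le_max lexx orbT.
apply/ereal_infP => _ [w _ <-]; rewrite -EFinM -EFinD lee_fin ge_max.
have kvw : (0 <= k * `|v - w|)%R by rewrite mulr_ge0// ltW.
apply/andP; split; first by rewrite addr_ge0// mulr_ge0 ?ler0n.
rewrite ge_min; have [pw|wp]/= := leP p w.
  by rewrite mulr1 lerDl kvw.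
rewrite mulr0 add0r ler_pM2l//; apply/orP; right.
by rewrite (le_trans _ (ler_norm _))//; lra.
Qed.

End penalized_revenue.

(** * The quadratic of the target equation *)

Section root_fragility.
Context {R : realType} (mu0 v1 v2 a1 tau : R).
Context (v12 : (v1 < v2)%R) (a1_ge0 : (0 <= a1)%R) (tau_gt0 : (0 < tau)%R)
  (tau_mu0 : (tau < mu0)%R).

Definition fragility_poly (r : R) : R :=
  (a1 * (v2 - v1) * r ^+ 2 - (mu0 - tau) * r + tau)%R.

Let k : R := root_fragility mu0 v1 v2 a1 tau.

(** A point where the quadratic is nonpositive lies between its two roots, or
    beyond its only root if a1 = 0.  Read contrapositively, the quadratic is
    positive below its smaller root. *)
Lemma root_fragility_le (x : R) : (fragility_poly x <= 0)%R -> (k <= x)%R.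
Proof.
rewrite /fragility_poly /k /root_fragility; case: eqVneq => [->|a1_neq0] Qx.
  by rewrite ler_pdivrMr ?subr_gt0//; lra.
have a1_gt0 : (0 < a1)%R by rewrite lt_neqAle eq_sym a1_neq0.
have A0 : (0 < a1 * (v2 - v1))%R by rewrite mulr_gt0// subr_gt0.
rewrite ler_pdivrMr; last by lra.
set D := (X in Num.sqrt X).
have : (`|2 * (a1 * (v2 - v1)) * x - (mu0 - tau)| <= Num.sqrt D)%R.
  by rewrite -sqrtr_sqr ler_wsqrtr// /D; have := mulr_ge0_le0 (ltW A0) Qx; lra.
by rewrite ler_norml => /andP[+ _]; lra.
Qed.

(** A point where the quadratic is nonpositive forces a nonnegative discriminant;
    the smaller root is positive because the product and the sum of the roots
    are.  For a1 = 0 the only root is positive because tau and mu0 - tau are. *)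
Lemma root_fragility_root (x : R) : (fragility_poly x <= 0)%R ->
  (0 < k)%R /\ fragility_poly k = 0%R.
Proof.
rewrite /fragility_poly /k /root_fragility; case: eqVneq => [->|a1_neq0] Qx.
  split; first by rewrite divr_gt0 ?subr_gt0.
  by field; rewrite subr_eq0 gt_eqF.
have a1_gt0 : (0 < a1)%R by rewrite lt_neqAle eq_sym a1_neq0.
have A0 : (0 < a1 * (v2 - v1))%R by rewrite mulr_gt0// subr_gt0.
set D := (X in Num.sqrt X).
have D0 : (0 <= D)%R.
  apply: le_trans (sqr_ge0 (2 * (a1 * (v2 - v1)) * x - (mu0 - tau))%R) _.
  by rewrite /D; have := mulr_ge0_le0 (ltW A0) Qx; lra.
have SE : (Num.sqrt D ^+ 2 = (mu0 - tau) ^+ 2 - 4 * a1 * tau * (v2 - v1))%R.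
  by rewrite sqr_sqrtr.
have S0 : (0 <= Num.sqrt D)%R by exact: sqrtr_ge0.
pose S : R := Num.sqrt D; rewrite -/S in SE S0 *; clearbody S; split.
  apply: divr_gt0; last by lra.
  have B0 : (0 <= mu0 - tau)%R by rewrite subr_ge0 ltW.
  rewrite subr_gt0 -(@ltr_pXn2r _ 2) ?nnegrE//.
  rewrite SE; have := mulr_gt0 A0 tau_gt0; lra.
have -> : (a1 * (v2 - v1) * ((mu0 - tau - S) / (2 * a1 * (v2 - v1))) ^+ 2 -
    (mu0 - tau) * ((mu0 - tau - S) / (2 * a1 * (v2 - v1))) + tau =
    (S ^+ 2 - ((mu0 - tau) ^+ 2 - 4 * a1 * tau * (v2 - v1))) /
    (4 * a1 * (v2 - v1)))%R.
  by field; rewrite subr_eq0 a1_neq0 gt_eqF.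
by rewrite SE subrr mul0r.
Qed.

End root_fragility.

(** The ratio fragility solves shading k * Pi = tau, and shading is increasing;
    for tau = Pi the solution is +oo. *)
Lemma shading_ratio_fragility (R : realType) (Pi tau : R) :
  (0 < tau)%R -> (tau <= Pi)%R ->
  [/\ 0 < ratio_fragility Pi tau,
      (shading (ratio_fragility Pi tau) * Pi = tau)%R &
      forall r, (0 < r)%R -> r%:E < ratio_fragility Pi tau ->
        (shading r%:E * Pi < tau)%R].
Proof.
move=> tau0; rewrite le_eqVlt /ratio_fragility inver => /predU1P[<-|tauPi].
  rewrite subrr eqxx gt0_muley ?lte_fin//; split => //=; first by rewrite mul1r.
  by move=> r r0 _; rewrite mulrAC ltr_pdivrMr ?addr_gt0//; lra.
have P0 : (0 < Pi - tau)%R by rewrite subr_gt0.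
rewrite gt_eqF//; split; first by rewrite -EFinM lte_fin divr_gt0.
  by rewrite /=; field; rewrite ?gt_eqF//; lra.
move=> r r0; rewrite -EFinM lte_fin ltr_pdivlMr// => rP /=.
by rewrite mulrAC ltr_pdivrMr ?addr_gt0//; lra.
Qed.

(** * Robust revenue against two valuations *)

Section two_values.
Context {R : realType} (v1 v2 a1 a2 : R).
Context (v1_ge0 : (0 <= v1)%R) (v12 : (v1 < v2)%R) (v2_le1 : (v2 <= 1)%R).
Context (a1_ge0 : (0 <= a1)%R) (a2_ge0 : (0 <= a2)%R) (a12 : (a1 + a2 = 1)%R).

Local Notation robust := (robust_revenue v1 v2 a1 a2).
Local Notation max_robust := (max_robust_revenue v1 v2 a1 a2).
Local Notation optimal := (rs_optimal v1 v2 a1 a2).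

Local Ltac expose_parameter_bounds :=
  move: v1_ge0 v12 v2_le1 a1_ge0 a2_ge0 a12 => ? ? ? ? ? ?.

Let v1_01 : v1 \in `[0%R, 1%R].
Proof. by expose_parameter_bounds; rewrite in_itv/=; lra. Qed.

Let v2_01 : v2 \in `[0%R, 1%R].
Proof. by expose_parameter_bounds; rewrite in_itv/=; lra. Qed.

Lemma robust_revenue_fin (k p : R) : (0 < k)%R -> p \in `[0%R, 1%R] ->
  robust k%:E p = (a1 * Num.max 0 (Num.min p (k * (v1 - p))) +
                   a2 * Num.max 0 (Num.min p (k * (v2 - p))))%:E.
Proof. by move=> k0 p01; rewrite /robust_revenue !penalized_revenue_fin. Qed.

Lemma robust_revenue_pinfty (p : R) :
  robust +oo p = (p * (a1 * (p <= v1)%R%:R + a2 * (p <= v2)%R%:R))%:E.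
Proof.
rewrite /robust_revenue !penalized_revenue_pinfty// -!EFinM -EFinD.
by congr EFin; ring.
Qed.

(** Nature can always leave the valuations unchanged, at no cost. *)
Lemma robust_revenue_le_pinfty (k : \bar R) (p : R) : robust k p <= robust +oo p.
Proof.
rewrite /robust_revenue !penalized_revenue_pinfty//.
by apply: leeD; apply: lee_wpmul2l; rewrite ?lee_fin//;
  exact: penalized_revenue_le_revenue.
Qed.

Lemma posted_price_revenue_two_point (p : R) :
  posted_price_revenue (two_point v1 v2 a1_ge0 a2_ge0 a12 : probability R R) p =
  robust +oo p.
Proof.
rewrite robust_revenue_pinfty /posted_price_revenue /= /two_point measure_addE.
set A := [set w | (p <= w)%R].
rewrite -[LHS]/(p%:E * (a1%:E * dirac v1 A + a2%:E * dirac v2 A)).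
rewrite !diracE EFinM; congr (_ * _).
by rewrite EFinD !EFinM; congr (_ * _ + _ * _); congr (_%:R%:E);
  congr (nat_of_bool _); apply/idP/idP; rewrite inE.
Qed.

Lemma shading_fin (r : R) : (0 < r)%R ->
  (0 < shading r%:E < 1)%R /\ (shading r%:E * (r + 1) = r)%R.
Proof.
move=> r0 /=; have r1 : (0 < r + 1)%R by lra.
rewrite divrK ?unitf_gt0// divr_gt0//= ltr_pdivrMr//; split => //; lra.
Qed.

(** The peak of the tent: at this price, pushing the valuation below the price
    costs nature as much as letting the sale happen. *)
Lemma shading_indifference (r v : R) : (0 < r)%R ->
  (r * (v - shading r%:E * v) = shading r%:E * v)%R.
Proof. by move=> r0 /=; field; rewrite gt_eqF// addr_gt0. Qed.

Lemma shading_itv (k : \bar R) : 0 < k -> (0 < shading k <= 1)%R.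
Proof.
case: k => [r| |]//=; last by rewrite ltr01 lexx.
by rewrite lte_fin => /shading_fin[/andP[? /ltW ?] _]; apply/andP.
Qed.

Lemma shading_price (k : \bar R) (v : R) :
  0 < k -> v \in `[0%R, 1%R] -> (shading k * v)%R \in `[0%R, 1%R].
Proof. by move=> /shading_itv; rewrite !in_itv/=; nra. Qed.

Lemma robust_revenue_low (k : \bar R) : 0 < k ->
  robust k (shading k * v1) = (shading k * v1)%:E.
Proof.
expose_parameter_bounds.
case: k => [r| |]// => [r0|_]; last first.
  by rewrite /= mul1r robust_revenue_pinfty lexx (ltW v12) !mulr1 a12 mulr1.
rewrite robust_revenue_fin//; last exact: shading_price.
move: r0; rewrite lte_fin => r0; have [/andP[s0 s1] sE] := shading_fin r0.
have e1 := shading_indifference v1 r0.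
set s : R := shading _ in e1 s0 s1 sE *; clearbody s.
rewrite e1 min_l// max_r ?mulr_ge0 ?(ltW s0)// min_l ?max_r ?mulr_ge0 ?(ltW s0)//.
  by rewrite -mulrDl a12 mul1r.
by rewrite -[leLHS]e1; nra.
Qed.

(** The robust revenue at the price s v2 if the low type were always charged the
    penalty k (v1 - s v2), even where that number is negative. *)
Definition two_value_revenue (r : R) : R :=
  (a1 * (r * (v1 - shading r%:E * v2)) + a2 * (shading r%:E * v2))%R.

Lemma robust_revenue_high (r : R) : (0 < r)%R ->
  robust r%:E (shading r%:E * v2) =
  (Num.max (a2 * (shading r%:E * v2)) (two_value_revenue r))%:E.
Proof.
expose_parameter_bounds.
move=> r0; rewrite robust_revenue_fin//; last exact: shading_price.
rewrite /two_value_revenue; have [/andP[s0 s1] sE] := shading_fin r0.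
have e2 := shading_indifference v2 r0.
set s : R := shading _ in e2 s0 s1 sE *; clearbody s.
have sv2 : (0 <= s * v2)%R by nra.
rewrite e2 minxx (max_r sv2) min_r; last by rewrite -[leRHS]e2; nra.
by rewrite maxr_pMr// mulr0 addr_maxl add0r.
Qed.

Lemma robust_revenue_high_pinfty : robust +oo (shading +oo * v2) = (a2 * v2)%:E.
Proof.
rewrite /= mul1r robust_revenue_pinfty lexx (leNgt v2) v12/=.
by congr EFin; ring.
Qed.

(** Outside the interval from s v1 to s v2, moving towards it does not lower the
    revenue; on it the revenue is convex, so that one of the endpoints is best. *)
Lemma robust_revenue_le_shading (k : \bar R) (p : R) : 0 < k ->
  p \in `[0%R, 1%R] ->
  robust k p <= maxe (robust k (shading k * v1)) (robust k (shading k * v2)).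
Proof.
expose_parameter_bounds.
case: k => [r| |]// => k0 p01; rewrite robust_revenue_low//; last first.
  rewrite robust_revenue_high_pinfty robust_revenue_pinfty /= -EFin_max lee_fin.
  have /andP[p0 p1] : (0 <= p <= 1)%R by rewrite in_itv in p01.
  rewrite le_max; have [pv1|pv1] := leP p v1.
    by have -> : (p <= v2)%R; [lra | apply/orP; left; rewrite /=; nra].
  by apply/orP; right; have [pv2|pv2] := leP p v2; rewrite /=; nra.
rewrite robust_revenue_high// robust_revenue_fin// -EFin_max lee_fin.
rewrite /two_value_revenue.
have /andP[p0 p1] : (0 <= p <= 1)%R by rewrite in_itv in p01.
have [/andP[s0 s1] sE] := shading_fin k0.
have e1 := shading_indifference v1 k0.
have e2 := shading_indifference v2 k0.
set s : R := shading _ in e1 e2 s0 s1 sE *; clearbody s.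
move: k0; rewrite lte_fin => r0.
set x1 : R := Num.max 0%R (Num.min p (r * (v1 - p)))%R.
set x2 : R := Num.max 0%R (Num.min p (r * (v2 - p)))%R.
have x1p : (x1 <= p)%R by rewrite ge_max p0 ge_min lexx.
have x2p : (x2 <= p)%R by rewrite ge_max p0 ge_min lexx.
have x1k : (x1 <= Num.max 0%R (r * (v1 - p)))%R.
  by rewrite ge_max !le_max !ge_min !lexx /= !orbT.
have x2k : (x2 <= Num.max 0%R (r * (v2 - p)))%R.
  by rewrite ge_max !le_max !ge_min !lexx /= !orbT.
clearbody x1 x2; rewrite !le_max.
have [psv1|psv1] := leP p (s * v1)%R; first by apply/orP; left; nra.
have [psv2|psv2] := leP p (s * v2)%R.
  have {}x2p : (a2 * x2 <= a2 * p)%R by rewrite ler_wpM2l.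
  move: x1k; rewrite le_max => /orP[x10|x1k].
    by apply/orP; right; apply/orP; left; nra.
  have {}x1k : (a1 * x1 <= a1 * (r * (v1 - p)))%R by rewrite ler_wpM2l.
  (* The slope a2 - a1 r on this piece decides which endpoint is better. *)
  have [a2k|a2k] := leP a2 (a1 * r)%R.
    have low : (a1 * (r * (v1 - s * v1)) + a2 * (s * v1) = s * v1)%R.
      by rewrite e1 -mulrDl a12 mul1r.
    have : (0 <= (a1 * r - a2) * (p - s * v1))%R.
      by rewrite mulr_ge0// subr_ge0// ltW.
    by move=> slope; apply/orP; left; lra.
  have : (0 <= (a2 - a1 * r) * (s * v2 - p))%R.
    by rewrite mulr_ge0// subr_ge0// ltW.
  by move=> slope; apply/orP; right; apply/orP; right; lra.
have {}x2k : (x2 <= s * v2)%R.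
  by apply: (le_trans x2k); rewrite -e2 ge_max; apply/andP; split; nra.
move: x1k; rewrite le_max => /orP[x10|x1k].
  by apply/orP; right; apply/orP; left; nra.
apply/orP; right; apply/orP; right; apply: lerD; rewrite ler_wpM2l//.
by apply: (le_trans x1k); nra.
Qed.

Lemma max_robust_revenueE (k : \bar R) : 0 < k ->
  max_robust k = maxe (robust k (shading k * v1)) (robust k (shading k * v2)).
Proof.
move=> k0; apply/eqP; rewrite eq_le; apply/andP; split.
  by apply/ereal_supP => _ [p p01 <-]; exact: robust_revenue_le_shading.
rewrite ge_max; apply/andP; split; apply: ereal_sup_ubound.
  by exists (shading k * v1)%R => //; exact: shading_price.
by exists (shading k * v2)%R => //; exact: shading_price.
Qed.

Lemma max_robust_revenue_attained (k : \bar R) : 0 < k ->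
  exists2 p, p \in `[0%R, 1%R] & robust k p = max_robust k.
Proof.
move=> k0; rewrite max_robust_revenueE// /maxe; case: ifPn => _.
  by exists (shading k * v2)%R => //; exact: shading_price.
by exists (shading k * v1)%R => //; exact: shading_price.
Qed.

Lemma max_robust_revenue_fin (r : R) : (0 < r)%R ->
  max_robust r%:E = (Num.max (shading r%:E * v1)
    (Num.max (a2 * (shading r%:E * v2)) (two_value_revenue r)))%:E.
Proof.
by move=> r0; rewrite max_robust_revenueE// robust_revenue_low//
  robust_revenue_high// -EFin_max.
Qed.

Lemma max_robust_revenue_pinfty : max_robust +oo = (Num.max v1 (a2 * v2))%:E.
Proof.
by rewrite max_robust_revenueE// robust_revenue_low// robust_revenue_high_pinfty
  -EFin_max /= mul1r.
Qed.

Lemma max_revenue_two_point :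
  max_revenue (two_point v1 v2 a1_ge0 a2_ge0 a12 : probability R R) =
  max_robust +oo.
Proof.
congr ereal_sup; apply/seteqP; split => _ [p p01 <-]; exists p => //;
  by rewrite posted_price_revenue_two_point.
Qed.

Lemma rs_feasibleP (tau : R) :
  (exists k, rs_feasible v1 v2 a1 a2 tau k) <-> tau%:E <= max_robust +oo.
Proof.
split=> [[k [k0 tauk]]|tauoo]; last by exists +oo; split.
apply: (le_trans tauk); apply/ereal_supP => _ [p p01 <-].
by apply: le_trans (robust_revenue_le_pinfty _ _) _; apply: ereal_sup_ubound; exists p.
Qed.

Lemma rs_optimal_intro (tau p : R) (k : \bar R) :
  0 < k -> p \in `[0%R, 1%R] -> max_robust k = tau%:E -> robust k p = tau%:E ->
  (forall r, (0 < r)%R -> r%:E < k -> max_robust r%:E < tau%:E) ->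
  optimal tau p k.
Proof.
move=> k0 p01 Mk Rk below; split=> //; [by rewrite /rs_feasible Mk| |by rewrite Mk].
move=> [r| |] [r0 tauM]; [|by rewrite leey|by []].
by rewrite leNgt; apply/negP => /(below _ r0); rewrite ltNge tauM.
Qed.

Lemma two_value_revenue_poly (tau r : R) : (0 < r)%R ->
  ((tau - two_value_revenue r) * (r + 1) =
   fragility_poly (a1 * v1 + a2 * v2) v1 v2 a1 tau r)%R.
Proof.
expose_parameter_bounds.
move=> r0; rewrite /two_value_revenue /fragility_poly /=.
have -> : a2 = (1 - a1)%R by lra.
by field; rewrite gt_eqF//; lra.
Qed.

Lemma two_value_revenueB_low (r : R) : (0 < r)%R ->
  (two_value_revenue r - shading r%:E * v1 =
   shading r%:E * (v2 - v1) * (a2 - a1 * r))%R.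
Proof.
expose_parameter_bounds.
move=> r0; rewrite /two_value_revenue /=.
have -> : a2 = (1 - a1)%R by lra.
by field; rewrite gt_eqF//; lra.
Qed.

(** When a2 <= a1 r the price s v1 is at least as good as s v2.  Otherwise, each
    unit of v1 - s v2 contributes at most a2, which gives a2 v1 if s v2 <= v1;
    and for s v2 > v1 the first term is nonpositive. *)
Lemma two_value_revenue_le (r : R) : (0 < r)%R ->
  (two_value_revenue r <= Num.max (a2 * v1) (shading r%:E * Num.max v1 (a2 * v2)))%R.
Proof.
expose_parameter_bounds.
move=> r0; have [/andP[s0 s1] sE] := shading_fin r0.
rewrite maxr_pMr ?(ltW s0)// !le_max.
have [a1r|a1r] := leP a2 (a1 * r)%R.
  apply/orP; right; apply/orP; left; rewrite -subr_le0 two_value_revenueB_low//.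
  by apply: mulr_ge0_le0; [apply: mulr_ge0|]; lra.
rewrite /two_value_revenue; move: s0 s1 sE; set s : R := shading _.
clearbody s => s0 s1 sE.
have [sv|sv] := leP (s * v2)%R v1.
  have : (0 <= (a2 - a1 * r) * (v1 - s * v2))%R.
    by rewrite mulr_ge0// subr_ge0// ltW.
  by move=> slope; apply/orP; left; lra.
have : (0 <= a1 * (r * (s * v2 - v1)))%R.
  by rewrite !mulr_ge0 ?subr_ge0// ltW.
by move=> low; apply/orP; right; apply/orP; right; lra.
Qed.

(** * Optimal fragilities *)

Local Notation Pi0 := (Num.max v1 (a2 * v2))%R.

Lemma robust_revenue_high_ge (k : \bar R) : 0 < k ->
  (a2 * (shading k * v2))%:E <= robust k (shading k * v2).
Proof.
case: k => [r| |]// => [r0|_]; last by rewrite robust_revenue_high_pinfty /= mul1r.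
by rewrite robust_revenue_high// lee_fin le_max lexx.
Qed.

Lemma max_robust_revenue_bounds (k : \bar R) : 0 < k ->
  (shading k * Pi0)%:E <= max_robust k <=
  (Num.max (a2 * v1) (shading k * Pi0))%:E.
Proof.
case: k => [r| |]// => [r0|_]; last first.
  by rewrite max_robust_revenue_pinfty /= mul1r !lee_fin lexx le_max lexx orbT.
have [/andP[s0 s1] _] := shading_fin r0.
rewrite max_robust_revenue_fin// !lee_fin maxA [(a2 * (_ * _))%R]mulrCA.
rewrite -maxr_pMr ?(ltW s0)// le_max lexx/= ge_max two_value_revenue_le//.
by rewrite le_max lexx orbT.
Qed.

(** The two bounds on r make s v1 and a2 s v2, respectively, at most the two-value
    revenue. *)
Lemma max_robust_revenue_two_value (r : R) : (0 < r)%R ->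
    (a1 * r <= a2)%R -> (r * (v2 - v1) <= v1)%R ->
  max_robust r%:E = (two_value_revenue r)%:E /\
  robust r%:E (shading r%:E * v2) = (two_value_revenue r)%:E.
Proof.
expose_parameter_bounds.
move=> r0 ar rd; have [/andP[s0 s1] sE] := shading_fin r0.
have gB := two_value_revenueB_low r0.
have sv1 : (shading r%:E * v1 <= two_value_revenue r)%R.
  by rewrite -subr_ge0 gB; apply: mulr_ge0; [apply: mulr_ge0|]; lra.
have sv2 : (shading r%:E * v2 <= v1)%R.
  by rewrite /= mulrAC ler_pdivrMr; lra.
have {}sv2 : (a2 * (shading r%:E * v2) <= two_value_revenue r)%R.
  rewrite /two_value_revenue lerDr; apply: mulr_ge0 => //.
  by apply: mulr_ge0; [exact: ltW|rewrite subr_ge0].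
by rewrite max_robust_revenue_fin// robust_revenue_high// (max_r sv2) (max_r sv1).
Qed.

(** Below the smaller root the maximal robust revenue is still the two-value
    revenue, where the positivity of the quadratic keeps it under tau. *)
Lemma rs_optimal_root (tau : R) : (0 < tau)%R -> (tau <= a2 * v1)%R ->
  let k := (root_fragility (a1 * v1 + a2 * v2) v1 v2 a1 tau)%:E in
  optimal tau (shading k * v2) k.
Proof.
expose_parameter_bounds.
move=> tau_gt0 tau_le k.
have a2v1 : (0 < a2 * v1)%R by exact: lt_le_trans tau_le.
have a2_gt0 : (0 < a2)%R.
  rewrite lt_neqAle a2_ge0 andbT; apply: contraTneq a2v1 => <-.
  by rewrite mul0r ltxx.
have tau_mu0 : (tau < a1 * v1 + a2 * v2)%R.
  by apply: (le_lt_trans tau_le); have := ltr_pM2l a2_gt0 v1 v2; rewrite v12; nra.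
have d0 : (0 < v2 - v1)%R by rewrite subr_gt0.
have le_root := root_fragility_le v12 a1_ge0 tau_mu0.
(* At k = v1 / (v2 - v1) the price s v2 is v1, and the two-value revenue a2 v1. *)
have Qv : (fragility_poly (a1 * v1 + a2 * v2) v1 v2 a1 tau (v1 / (v2 - v1)) <= 0)%R.
  have -> : (fragility_poly (a1 * v1 + a2 * v2) v1 v2 a1 tau (v1 / (v2 - v1)) =
      v2 / (v2 - v1) * (tau - a2 * v1))%R.
    rewrite /fragility_poly; have -> : a2 = (1 - a1)%R by lra.
    by field; rewrite gt_eqF.
  by apply: mulr_ge0_le0; [rewrite divr_ge0// ltW//; lra|rewrite subr_le0].
have [] := root_fragility_root v12 a1_ge0 tau_gt0 tau_mu0 Qv.
rewrite {}/k; move: le_root (le_root _ Qv); move: (root_fragility _ _ _ _ _) => r.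
move=> le_root; rewrite ler_pdivlMr// => rv r0 Qr.
have ra : (a1 * r <= a2)%R.
  have [->|a1_neq0] := eqVneq a1 0%R; first by rewrite mul0r.
  have a1_gt0 : (0 < a1)%R by rewrite lt_neqAle eq_sym a1_neq0.
  (* At k = a2 / a1 one has s = a2, and the two-value revenue is again a2 v1. *)
  rewrite mulrC -ler_pdivlMr//; apply: le_root.
  have -> : (fragility_poly (a1 * v1 + a2 * v2) v1 v2 a1 tau (a2 / a1) =
      (tau - a2 * v1) / a1)%R.
    by rewrite /fragility_poly; have -> : a2 = (1 - a1)%R by [lra]; field.
  by rewrite pmulr_lle0 ?invr_gt0// subr_le0.
have gr : two_value_revenue r = tau.
  have := two_value_revenue_poly tau r0; rewrite Qr => /eqP.
  by rewrite mulf_eq0 [X in _ || X]gt_eqF ?addr_gt0// orbF subr_eq0 => /eqP.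
have [Mr Rr] := max_robust_revenue_two_value r0 ra rv.
apply: rs_optimal_intro; rewrite ?lte_fin ?Mr ?Rr ?gr//; first exact: shading_price.
move=> x x0; rewrite lte_fin => xr.
have [|| -> _] := @max_robust_revenue_two_value x x0; [nra|nra|].
rewrite lte_fin -subr_gt0 -(pmulr_lgt0 _ (addr_gt0 x0 ltr01)) two_value_revenue_poly//.
by rewrite ltNge; apply/negP => /le_root; rewrite leNgt xr.
Qed.

(** The part of the bounds on the maximal robust revenue that does not scale with
    the shading is a2 v1, too small to reach tau. *)
Lemma rs_optimal_ratio (tau : R) : (0 < tau)%R -> (a2 * v1 < tau <= Pi0)%R ->
  let k := ratio_fragility Pi0 tau in
  (Pi0 = v1 -> optimal tau (shading k * v1) k) /\
  (Pi0 = a2 * v2 -> optimal tau (shading k * v2) k)%R.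
Proof.
move=> tau_gt0 /andP[tau_gt tau_le] k.
have [] := shading_ratio_fragility tau_gt0 tau_le; rewrite -/k => k0 sk below.
have Mk : max_robust k = tau%:E.
  apply/eqP; rewrite eq_le andbC; have := max_robust_revenue_bounds k0.
  by rewrite sk (max_r (ltW tau_gt)).
have Mr r : (0 < r)%R -> r%:E < k -> max_robust r%:E < tau%:E.
  move=> r0 rk; have /andP[_] := @max_robust_revenue_bounds r%:E r0.
  by move=> /le_lt_trans; apply; rewrite lte_fin gt_max tau_gt below.
split=> PiE; (apply: rs_optimal_intro => //; first exact: shading_price).
  by rewrite robust_revenue_low// -PiE sk.
apply/eqP; rewrite eq_le; apply/andP; split.
  rewrite -Mk; apply: ereal_sup_ubound; exists (shading k * v2)%R => //.
  exact: shading_price.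
by apply: le_trans (robust_revenue_high_ge k0); rewrite mulrCA -PiE sk.
Qed.

End two_values.

Theorem proposition6 (R : realType) (v1 v2 a1 a2 tau : R)
    (v1_ge0 : (0 <= v1)%R) (v12 : (v1 < v2)%R) (v2_le1 : (v2 <= 1)%R)
    (a1_ge0 : (0 <= a1)%R) (a2_ge0 : (0 <= a2)%R) (a12 : (a1 + a2 = 1)%R)
    (tau_gt0 : (0 < tau)%R) :
  let P0 : probability R R := two_point v1 v2 a1_ge0 a2_ge0 a12 in
  let mu0 := mean P0 in
  let Pi0 := max_revenue P0 in
  let kroot := root_fragility (fine mu0) v1 v2 a1 tau in
  let optimal := rs_optimal v1 v2 a1 a2 tau in
  mu0 = (a1 * v1 + a2 * v2)%:E /\
  (exists2 p, p \in `[0%R, 1%R] & posted_price_revenue P0 p = Pi0) /\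
  Pi0 = (Num.max v1 ((1 - a1) * v2))%:E /\
  (forall k, 0 < k -> exists2 p, p \in `[0%R, 1%R] &
     robust_revenue v1 v2 a1 a2 k p = max_robust_revenue v1 v2 a1 a2 k) /\
  ((exists k, rs_feasible v1 v2 a1 a2 tau k) <-> tau%:E <= Pi0) /\
  ((v1 <= (1 - a1) * v2)%R ->
     Pi0 = ((1 - a1) * v2)%:E /\
     ((tau <= (1 - a1) * v1)%R ->
        let k := kroot%:E in optimal (shading k * v2)%R k) /\
     (((1 - a1) * v1 < tau <= (1 - a1) * v2)%R ->
        let k := ratio_fragility ((1 - a1) * v2)%R tau in
        optimal (shading k * v2)%R k)) /\
  (((1 - a1) * v2 < v1)%R ->
     Pi0 = v1%:E /\
     ((tau <= (1 - a1) * v1)%R ->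
        let k := kroot%:E in optimal (shading k * v2)%R k) /\
     (((1 - a1) * v1 < tau <= v1)%R ->
        let k := ratio_fragility v1 tau in
        optimal (shading k * v1)%R k)).
Proof.
move=> P0 mu0 Pi0 kroot optimal.
have a2E : (1 - a1 = a2)%R by rewrite -a12 addrC addKr.
have mu0E : mu0 = (a1 * v1 + a2 * v2)%:E by exact: mean_two_point.
have Pi0E : Pi0 = max_robust_revenue v1 v2 a1 a2 +oo.
  exact: max_revenue_two_point.
have Pi0V : Pi0 = (Num.max v1 (a2 * v2))%:E.
  by rewrite Pi0E max_robust_revenue_pinfty.
have root (tau_le : (tau <= a2 * v1)%R) : optimal (shading kroot%:E * v2)%R kroot%:E.
  by rewrite /kroot mu0E; apply: rs_optimal_root.
have ratio := rs_optimal_ratio v1_ge0 v12 v2_le1 a1_ge0 a2_ge0 a12 tau_gt0.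
rewrite a2E; split=> //; split; first last.
  split=> //; split; first by move=> k; apply: max_robust_revenue_attained.
  split; first by rewrite Pi0E; apply: rs_feasibleP.
  split=> [v1_le|v1_gt]; rewrite Pi0V.
    by rewrite (max_r v1_le) in ratio *; split=> //; split=> [/root|/ratio[_]]//; apply.
  rewrite (max_l (ltW v1_gt)) in ratio *.
  by split=> //; split=> [/root|/ratio[+ _]]//; apply.
rewrite Pi0E; have [p p01 pE] :=
  max_robust_revenue_attained v1_ge0 v12 v2_le1 a1_ge0 a2_ge0 a12 (ltry 0%R).
by exists p; rewrite // posted_price_revenue_two_point.
Qed.
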